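(* Let $f:\mathbb{R}^n\to\mathbb{R}$ be twice continuously differentiable with $f_{\inf}:=\inf f>-\infty$. Suppose that $\nabla^2 f$ is $M$-Lipschitz continuous ($M>0$) on an open convex set $X$ containing all the iterates $x_k$ of HSODM (the algorithm described in the context), and that $\|\nabla^2 f(x_k)\|\le U_H$ for all $k$, for some $U_H>0$. Let $\delta=\sqrt{\epsilon}$, $\Delta=2\sqrt{\epsilon}/M$ and $\nu\in(0,1/2)$. Then HSODM with the fixed-radius strategy terminates in at most $O(\epsilon^{-3/2})$ steps, and, when it terminates at iteration $k$, the next iterate $x_{k+1}$ is an $\epsilon$-approximate second-order stationary point, i.e. $\|\nabla f(x_{k+1})\|\le O(\epsilon)$ and $\lambda_1(\nabla^2 f(x_{k+1}))\ge\Omega(-\sqrt{\epsilon})$.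
   Context: Notation: $\|\cdot\|$ is the Euclidean norm (induced $\ell_2$ norm for matrices), $\lambda_1(A)$ is the smallest eigenvalue of a symmetric matrix $A$, $[a;b]$ is vertical concatenation. The constants hidden in $O$, $\Omega$ do not depend on $\epsilon$ or $k$ (they may depend on $M$, $U_H$ and $f(x_1)-f_{\inf}$); $\lambda\ge\Omega(-\sqrt\epsilon)$ means $\lambda\ge -c\sqrt\epsilon$ for such a constant $c>0$. The tolerance $\epsilon>0$ is small enough that $\Delta\le\sqrt2/2$. HSODM (Homogeneous Second-Order Descent Method) with the fixed-radius strategy. Input: initial point $x_1\in\mathbb{R}^n$ and parameters $\delta\ge0$, $\Delta>0$, $\nu\in(0,1/2)$. For $k=1,2,\dots$: let $g_k=\nabla f(x_k)$, $H_k=\nabla^2 f(x_k)$, and $$F_k=\begin{bmatrix}H_k & g_k\\ g_k^T & -\delta\end{bmatrix}.$$ Compute an optimal solution $[v_k;t_k]$ ($v_k\in\mathbb{R}^n$, $t_k\in\mathbb{R}$) of $\min_{\|[v;t]\|\le1}[v;t]^TF_k[v;t]$, i.e. a unit eigenvector of $F_k$ for its smallest eigenvalue. (i) Small value case: if $|t_k|>\sqrt{1/(1+\Delta^2)}$, set $d_k=v_k/t_k$, $x_{k+1}=x_k+d_k$, and terminate. (ii) Large value case (a): otherwise, if $|t_k|\ge\nu$, set $d_k=v_k/t_k$. (iii) Large value case (b): otherwise ($|t_k|<\nu$), set $d_k=\operatorname{sign}(-g_k^Tv_k)\,v_k$, where $\operatorname{sign}(0)$ is taken to be $1$. In cases (ii)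 and (iii), set $\eta_k=\Delta/\|d_k\|$ and $x_{k+1}=x_k+\eta_kd_k$, and continue. *)

(* Defs.v *)
From HB Require Import structures.
From mathcomp Require Import all_boot all_order all_algebra.
From mathcomp Require Import all_classical all_reals all_analysis.
Set Implicit Arguments.
Unset Strict Implicit.
Unset Printing Implicit Defensive.
Import Order.TTheory GRing.Theory Num.Theory.
Import numFieldNormedType.Exports.
Local Open Scope classical_set_scope.
Local Open Scope ring_scope.

(* The library norm on ['cV[R]_n] is the sup norm, which induces the usual
   topology and differentiability; metric quantities use [enorm] instead. *)
Definition enorm (R : realType) (n : nat) (u : 'cV[R]_n) : R :=
  Num.sqrt (\sum_(i < n) u i 0 ^+ 2).

Definition opnorm (R : realType) (n : nat) (A : 'M[R]_n) : R :=
  sup [set enorm (A *m u) | u in [set u : 'cV[R]_n | enorm u <= 1]].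

Definition quad (R : realType) (n : nat) (A : 'M[R]_n) (u : 'cV[R]_n) : R :=
  (u^T *m A *m u) 0 0.

Definition smallest_eigenvalue (R : realType) (n : nat) (A : 'M[R]_n) (l : R) :
    Prop :=
  eigenvalue A l /\ forall a : R, eigenvalue A a -> l <= a.

Definition grad (R : realType) (n : nat) (f : 'cV[R]_n -> R) (x : 'cV[R]_n) :
    'cV[R]_n :=
  \col_(i < n) 'D_(delta_mx i 0) f x.

Definition hess (R : realType) (n : nat) (f : 'cV[R]_n -> R) (x : 'cV[R]_n) :
    'M[R]_n :=
  \matrix_(i < n, j < n)
    'D_(delta_mx j 0) (fun y : 'cV[R]_n => grad f y i 0) x.

Definition twice_continuously_differentiable (R : realType) (n : nat)
    (f : 'cV[R]_n -> R) : Prop :=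
  [/\ forall x : 'cV[R]_n, differentiable f x,
      forall x : 'cV[R]_n, differentiable (grad f) x
    & continuous (hess f)].

Definition hess_lipschitz_on (R : realType) (n : nat) (f : 'cV[R]_n -> R)
    (M : R) (X : set 'cV[R]_n) : Prop :=
  forall x y : 'cV[R]_n, X x -> X y ->
    opnorm (hess f x - hess f y) <= M * enorm (x - y).

Definition homogenized (R : realType) (n : nat) (f : 'cV[R]_n -> R) (delta : R)
    (x : 'cV[R]_n) : 'M[R]_(n + 1) :=
  block_mx (hess f x) (grad f x) (grad f x)^T (- delta)%:M.

Definition ball_minimizer (R : realType) (m : nat) (F : 'M[R]_m)
    (w : 'cV[R]_m) : Prop :=
  enorm w <= 1 /\ forall u : 'cV[R]_m, enorm u <= 1 -> quad F w <= quad F u.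

(* Unlike [Num.sg], takes the value 1 at 0. *)
Definition sign1 (R : realType) (a : R) : R := if 0 <= a then 1 else -1.

Definition small_value (R : realType) (Delta t : R) : bool :=
  Num.sqrt (1 / (1 + Delta ^+ 2)) < `|t|.

Definition hsodm_direction (R : realType) (n : nat) (Delta nu : R)
    (g v : 'cV[R]_n) (t : R) : 'cV[R]_n :=
  if small_value Delta t then t^-1 *: v
  else if nu <= `|t| then t^-1 *: v
  else sign1 ((- g^T *m v) 0 0) *: v.

Definition hsodm_next (R : realType) (n : nat) (Delta nu : R)
    (g v : 'cV[R]_n) (t : R) (x : 'cV[R]_n) : 'cV[R]_n :=
  let d := hsodm_direction Delta nu g v t in
  if small_value Delta t then x + d else x + (Delta / enorm d) *: d.

(* Iterations are numbered from 0, so [x 0] is the initial point and iteration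
   [k] computes [x k.+1] from [x k].  Iteration [k] is executed when no earlier
   one has terminated; the sequences are unconstrained after termination. *)
Definition executed (R : realType) (Delta : R) (t : nat -> R) (k : nat) : Prop :=
  forall j : nat, (j < k)%N -> ~~ small_value Delta (t j).

Definition terminates_at (R : realType) (Delta : R) (t : nat -> R) (k : nat) :
    Prop :=
  executed Delta t k /\ small_value Delta (t k).

(* [x k] is an iterate when iteration [k.-1] is executed (or [k = 0]); this
   includes the point returned on termination. *)
Definition is_iterate (R : realType) (Delta : R) (t : nat -> R) (k : nat) :
    Prop :=
  executed Delta t k.-1.

Definition hsodm_run (R : realType) (n : nat) (f : 'cV[R]_n -> R)
    (delta Delta nu : R) (x v : nat -> 'cV[R]_n) (t : nat -> R) : Prop :=
  forall k : nat, executed Delta t k ->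
    ball_minimizer (homogenized f delta (x k)) (col_mx (v k) (t k)%:M) /\
    x k.+1 = hsodm_next Delta nu (grad f (x k)) (v k) (t k) (x k).

(* Main.v *)
Require Import Defs.
From HB Require Import structures.
From mathcomp Require Import all_boot all_order all_algebra.
From mathcomp Require Import all_classical all_reals all_analysis.
From mathcomp Require Import ring lra.

Import Order.TTheory GRing.Theory Num.Theory.
Import numFieldNormedType.Exports.
Local Open Scope classical_set_scope.
Local Open Scope ring_scope.

(* Optimality of [v; t] for the homogenized matrix means, with [- theta] its
   smallest eigenvalue and [theta >= delta > 0],
     H v + t g = - theta v,   g.v = t (delta - theta),   H + theta I >= 0.
   In the large value cases the step has length Delta, and the cubic upper model
   of f shows that f decreases by at least
   theta Delta^2 / 2 - M Delta^3 / 6 >= M Delta^3 / 12, so that there are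
   O(eps^(-3/2)) of them.  In the small value case d = v / t satisfies
   |d| <= Delta, H d + g = - theta d and g.d = delta - theta; these bound theta by
   O(sqrt eps), and the Lipschitz Hessian transfers the bounds to x + d. *)

(** * Euclidean inner product and norm, the operator norm, and minimizers of quadratic forms *)

Definition dot {R : realType} {n : nat} (u v : 'cV[R]_n) : R := (u^T *m v) 0 0.

Section Euclidean.
Context {R : realType} {n : nat}.
Implicit Types (u v w : 'cV[R]_n) (A : 'M[R]_n) (a : R).

Lemma dotE u v : dot u v = \sum_i u i 0 * v i 0.
Proof. by rewrite /dot mxE; apply: eq_bigr => i _; rewrite mxE. Qed.

Lemma dotC u v : dot u v = dot v u.
Proof. by rewrite !dotE; apply: eq_bigr => i _; rewrite mulrC. Qed.

Lemma dotDr u v w : dot u (v + w) = dot u v + dot u w.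
Proof. by rewrite /dot mulmxDr mxE. Qed.

Lemma dotZr a u v : dot u (a *: v) = a * dot u v.
Proof. by rewrite /dot -scalemxAr mxE. Qed.

Lemma dotNr u v : dot u (- v) = - dot u v.
Proof. by rewrite /dot mulmxN mxE. Qed.

Lemma dot0r u : dot u 0 = 0.
Proof. by rewrite /dot mulmx0 mxE. Qed.

Lemma dotDl u v w : dot (u + v) w = dot u w + dot v w.
Proof. by rewrite dotC dotDr !(dotC w). Qed.

Lemma dotZl a u v : dot (a *: u) v = a * dot u v.
Proof. by rewrite dotC dotZr (dotC v). Qed.

Lemma dotNl u v : dot (- u) v = - dot u v.
Proof. by rewrite dotC dotNr (dotC v). Qed.

Lemma dot_mulmx A u v : dot u (A *m v) = dot (A^T *m u) v.
Proof. by rewrite /dot trmx_mul trmxK mulmxA. Qed.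

Lemma quadE A u : quad A u = dot u (A *m u).
Proof. by rewrite /quad /dot mulmxA. Qed.

Lemma quadZ A a u : quad A (a *: u) = a ^+ 2 * quad A u.
Proof. by rewrite !quadE -scalemxAr dotZl dotZr; ring. Qed.

Lemma enorm_ge0 u : 0 <= enorm u.
Proof. exact: sqrtr_ge0. Qed.

Lemma sqr_enorm u : enorm u ^+ 2 = dot u u.
Proof.
rewrite sqr_sqrtr ?dotE; last by apply: sumr_ge0 => i _; exact: sqr_ge0.
by apply: eq_bigr => i _; rewrite expr2.
Qed.

Lemma enormE u : enorm u = Num.sqrt (dot u u).
Proof. by rewrite -sqr_enorm sqrtr_sqr ger0_norm ?enorm_ge0. Qed.

Lemma enormN u : enorm (- u) = enorm u.
Proof. by rewrite !enormE dotNl dotNr opprK. Qed.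

Lemma dot_ge0 u : 0 <= dot u u.
Proof. by rewrite -sqr_enorm sqr_ge0. Qed.

Lemma enormZ a u : enorm (a *: u) = `|a| * enorm u.
Proof.
by rewrite !enormE dotZl dotZr mulrA -expr2 sqrtrM ?sqr_ge0// sqrtr_sqr.
Qed.

Lemma enorm0 : enorm (0 : 'cV[R]_n) = 0.
Proof. by rewrite enormE dot0r sqrtr0. Qed.

Lemma enorm_eq0 u : (enorm u == 0) = (u == 0).
Proof.
apply/eqP/eqP => [u0|->]; last exact: enorm0.
have : dot u u = 0 by rewrite -sqr_enorm u0 expr0n.
rewrite dotE => /eqP; rewrite psumr_eq0; last first.
  by move=> i _; rewrite -expr2 sqr_ge0.
move=> /allP h; apply/matrixP => i j; rewrite (ord1 j) mxE.
by have := h i (mem_index_enum i); rewrite /= mulf_eq0 orbb => /eqP.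
Qed.

Lemma enorm_gt0 u : (0 < enorm u) = (u != 0).
Proof. by rewrite lt_def enorm_ge0 andbT enorm_eq0. Qed.

Lemma normr_dot_le u v : `|dot u v| <= enorm u * enorm v.
Proof.
rewrite -ler_sqr ?nnegrE ?mulr_ge0 ?enorm_ge0// exprMn !sqr_enorm real_normK ?num_real//.
have [->|v0] := eqVneq v 0; first by rewrite !dot0r mulr0 expr0n.
have vp : 0 < dot v v by rewrite -sqr_enorm exprn_gt0// enorm_gt0.
(* Cauchy-Schwarz: the square of this vector, which is orthogonal to [v], is [dot v v] times the
   wanted difference. *)
have := dot_ge0 (dot v v *: u - dot u v *: v).
rewrite !(dotDl, dotDr, dotNl, dotNr, dotZl, dotZr) (dotC v u).
rewrite [X in 0 <= X](_ : _ =
  dot v v * (dot u u * dot v v - dot u v ^+ 2)); last by ring.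
by rewrite pmulr_rge0// subr_ge0.
Qed.

Lemma dot_le u v : dot u v <= enorm u * enorm v.
Proof. exact: le_trans (ler_norm _) (normr_dot_le u v). Qed.

Lemma enormD u v : enorm (u + v) <= enorm u + enorm v.
Proof.
rewrite -ler_sqr ?nnegrE ?addr_ge0 ?enorm_ge0// sqrrD !sqr_enorm.
rewrite dotDl !dotDr (dotC v u); have := dot_le u v; lra.
Qed.

(** Test with [u = w]. This reduces a bound on a vector to bounds on its scalar products, to which
    the one-variable mean value theorem applies. *)
Lemma enorm_le_dual (c : R) w : 0 <= c ->
  (forall u, dot u w <= c * enorm u) -> enorm w <= c.
Proof.
move=> c0 h; have [->|w0] := eqVneq w 0; first by rewrite enorm0.
by have := h w; rewrite -sqr_enorm expr2 ler_pM2r// enorm_gt0.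
Qed.

(** The Frobenius norm serves as [c], by Cauchy-Schwarz on each row. Some such bound is needed for
    the supremum in [opnorm] to be an actual upper bound. *)
Lemma enorm_bounded_mulmx A : exists c : R, forall u, enorm (A *m u) <= c * enorm u.
Proof.
pose r i := (row i A)^T; exists (Num.sqrt (\sum_i dot (r i) (r i))) => u.
rewrite -[leLHS]ger0_norm ?enorm_ge0// -sqrtr_sqr sqr_enorm.
rewrite enormE -sqrtrM ?sumr_ge0// => [|i _]; last exact: dot_ge0.
rewrite ler_wsqrtr// dotE mulr_suml; apply: ler_sum => i _.
have -> : (A *m u) i 0 = dot (r i) u.
  by rewrite mxE dotE; apply: eq_bigr => j _; rewrite !mxE.
by rewrite -expr2 -!sqr_enorm -exprMn -[leLHS]real_normK ?num_real//
  ler_sqr ?nnegrE ?mulr_ge0 ?enorm_ge0// normr_dot_le.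
Qed.

Lemma enorm_mulmx_le A u : enorm (A *m u) <= opnorm A * enorm u.
Proof.
have [->|u0] := eqVneq u 0; first by rewrite mulmx0 enorm0 mulr0.
have up : 0 < enorm u by rewrite enorm_gt0.
have -> : A *m u = enorm u *: (A *m ((enorm u)^-1 *: u)).
  by rewrite -scalemxAr scalerA divff ?scale1r// gt_eqF.
rewrite enormZ ger0_norm ?enorm_ge0// mulrC ler_pM2r//.
apply: ub_le_sup; last first.
  exists ((enorm u)^-1 *: u) => //=.
  by rewrite enormZ ger0_norm ?invr_ge0 ?enorm_ge0// mulVf ?gt_eqF.
have [c hc] := enorm_bounded_mulmx A; exists `|c| => _ [w /= w1 <-].
rewrite (le_trans (hc w))// (le_trans (ler_wpM2r (enorm_ge0 w) (ler_norm c)))//.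
by rewrite ler_piMr.
Qed.

Lemma opnorm_ge0 A : 0 <= opnorm A.
Proof.
have [c hc] := enorm_bounded_mulmx A.
apply: (@le_trans _ _ (enorm (A *m 0))); first exact: enorm_ge0.
apply: ub_le_sup; last by exists 0 => //=; rewrite enorm0.
exists `|c| => _ [w /= w1 <-].
rewrite (le_trans (hc w))// (le_trans (ler_wpM2r (enorm_ge0 w) (ler_norm c)))//.
by rewrite ler_piMr.
Qed.

Lemma normr_dot_mulmx_le A u v : `|dot u (A *m v)| <= opnorm A * (enorm u * enorm v).
Proof.
rewrite (le_trans (normr_dot_le _ _))// mulrCA ler_wpM2l ?enorm_ge0//.
exact: enorm_mulmx_le.
Qed.

Lemma quad_perturb_le A B u : quad A u - opnorm (B - A) * enorm u ^+ 2 <= quad B u.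
Proof.
have := normr_dot_mulmx_le (B - A) u u; rewrite mulmxBl dotDr dotNr -!quadE -expr2.
by rewrite ler_norml => /andP[h _]; move: h; lra.
Qed.

(* The derivative of [quad A] vanishes at a zero [w] of [quad A], as [w] is a
   minimizer; the proof tests the increment [w - s (A w)]. *)
Lemma psd_quad_eq0 A w : A^T = A -> (forall u, 0 <= quad A u) -> quad A w = 0 ->
  A *m w = 0.
Proof.
move=> As A0 Aw; set z := A *m w.
have key (s : R) : 0 < s -> 2 * dot z z <= s * quad A z.
  move=> s0; have := A0 (w - s *: z).
  rewrite !quadE in Aw *; rewrite !(mulmxDr, mulmxN) -scalemxAr.
  rewrite !(dotDl, dotDr, dotNl, dotNr, dotZl, dotZr) Aw -/z.
  rewrite (dot_mulmx A w) As -/z => h.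
  by rewrite -(ler_pM2l s0); move: h; lra.
have : dot z z <= 0.
  have [q0|q0] := leP (quad A z) 0; first by have := key 1 ltr01; lra.
  rewrite leNgt; apply/negP => zp.
  have := key (dot z z / quad A z) (divr_gt0 zp q0).
  by rewrite divfK ?gt_eqF//; lra.
rewrite -sqr_enorm => h; apply/eqP; rewrite -enorm_eq0 -sqrf_eq0.
by rewrite eq_le h sqr_ge0.
Qed.

(** The matrix [A - c%:M] is positive semidefinite and its form vanishes at [w], so [psd_quad_eq0]
    puts [w] in its kernel. *)
Lemma quad_lb_eigen A (c : R) w : A^T = A ->
  (forall u, c * enorm u ^+ 2 <= quad A u) -> quad A w = c * enorm w ^+ 2 ->
  A *m w = c *: w.
Proof.
move=> As Ac Aw.
have qB u : quad (A - c%:M) u = quad A u - c * enorm u ^+ 2.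
  by rewrite !quadE mulmxBl mul_scalar_mx dotDr dotNr dotZr sqr_enorm.
have : (A - c%:M) *m w = 0.
  apply: psd_quad_eq0.
  - by rewrite linearB/= tr_scalar_mx As.
  - by move=> u; rewrite qB subr_ge0.
  - by rewrite qB Aw subrr.
by rewrite mulmxBl mul_scalar_mx => /eqP; rewrite subr_eq0 => /eqP.
Qed.

Lemma quad_lb_sphere A (c : R) : (forall u, enorm u = 1 -> c <= quad A u) ->
  forall u, c * enorm u ^+ 2 <= quad A u.
Proof.
move=> h u; have [->|u0] := eqVneq u 0.
  by rewrite enorm0 expr0n mulr0 quadE dotC dot0r.
have up : 0 < enorm u by rewrite enorm_gt0.
have -> : quad A u = enorm u ^+ 2 * quad A ((enorm u)^-1 *: u).
  by rewrite -quadZ scalerA divff ?scale1r// gt_eqF.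
rewrite mulrC ler_pM2l ?exprn_gt0//; apply: h.
by rewrite enormZ ger0_norm ?invr_ge0 ?enorm_ge0// mulVf ?gt_eqF.
Qed.

Lemma ball_minimizer_eigen A w : A^T = A -> ball_minimizer A w -> quad A w < 0 ->
  [/\ enorm w = 1, A *m w = quad A w *: w &
      forall u, quad A w * enorm u ^+ 2 <= quad A u].
Proof.
move=> As [w1 hw] w0.
have lb : forall u, quad A w * enorm u ^+ 2 <= quad A u.
  by apply: quad_lb_sphere => u u1; apply: hw; rewrite u1.
(* With [q = quad A w < 0], the bound [lb] at [w] reads [q * enorm w ^+ 2 <= q], which forces
   [enorm w] to be at least 1. *)
have e1 : enorm w = 1.
  apply/eqP; rewrite eq_le w1/=; have := lb w.
  rewrite -subr_ge0 -[X in X - _]mulr1 -mulrBr nmulr_rge0// subr_le0.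
  by rewrite -{1}(expr1n _ 2) ler_sqr ?nnegrE ?enorm_ge0.
by split=> //; apply: quad_lb_eigen => //; rewrite e1 expr1n mulr1.
Qed.

End Euclidean.

(** * Existence of the smallest eigenvalue of a symmetric matrix *)

Section Eigenvalues.
Context {R : realType}.

(** Phrased with row vectors because [bounded_closed_compact] and [EVT_min_rV] are applied to a set
    of row vectors below. *)
Lemma continuous_dot_mulmx n (A : 'M[R]_n) :
  continuous (fun r : 'rV[R]_n => dot r^T (A *m r^T)).
Proof.
have -> : (fun r : 'rV[R]_n => dot r^T (A *m r^T)) =
  (fun r => \sum_i (r 0 i * \sum_j (A i j * r 0 j))).
  apply/funext => r; rewrite dotE; apply: eq_bigr => i _.
  by rewrite !mxE; congr (_ * _); apply: eq_bigr => j _; rewrite mxE.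
have C (g : 'I_n -> 'rV[R]_n -> R) r : (forall i, differentiable (g i) r) ->
    differentiable (fun r => \sum_i g i r) r.
  move=> /differentiable_sum dg; rewrite (_ : (fun _ => _) = \sum_i g i)//.
  by apply/funext => s; rewrite fct_sumE.
move=> r; apply: differentiable_continuous; apply: (C) => i.
apply: (@differentiableM _ _ (fun r : 'rV[R]_n => r 0 i)).
  exact: differentiable_coord.
apply: C => j; apply: (@differentiableM _ _ (fun=> A i j)) => //.
exact: differentiable_coord.
Qed.

(** The form attains its minimum on the compact unit sphere, nonempty as [0 < n]. The minimizer is
    an eigenvector by [quad_lb_eigen], and evaluating the form at any other eigenvector shows that
    its eigenvalue is no smaller. *)
Lemma smallest_eigenvalue_exists n (A : 'M[R]_n) (c : R) : (0 < n)%N -> A^T = A ->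
  (forall u, c * enorm u ^+ 2 <= quad A u) ->
  exists2 l : R, smallest_eigenvalue A l & c <= l.
Proof.
move=> n0 As Ac.
pose S : set 'rV[R]_n := [set r | dot r^T r^T = 1].
have cS : compact S.
  apply: bounded_closed_compact.
    exists 1; split; first exact: num_real.
    move=> M M1 r /= Sr; apply: (@le_trans _ _ 1); last exact: ltW.
    (* The library norm is the largest absolute entry, and each squared entry is at most the sum of
       squares, equal to 1 on [S]. *)
    rewrite [leLHS]/Num.Def.normr /= mx_normrE; apply: bigmax_le => //= -[i j] _ /=.
    rewrite (ord1 i) -(@expr_le1 _ 2)// real_normK ?num_real// -Sr dotE.
    rewrite (bigD1 j)//= !mxE expr2 lerDl; apply: sumr_ge0 => k _.
    by rewrite !mxE -expr2 sqr_ge0.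
  rewrite (_ : S = (fun r : 'rV[R]_n => dot r^T (1%:M *m r^T)) @^-1` [set 1]).
    apply: preimage_closed => [r _|]; first exact: continuous_dot_mulmx.
    exact: closed_eq.
  by apply/seteqP; split => r; rewrite /S/= mul1mx.
have S0 : S !=set0.
  exists (delta_mx 0 (Ordinal n0)); rewrite /S/= trmx_delta dotE.
  rewrite (bigD1 (Ordinal n0))//= !mxE !eqxx mulr1 big1 ?addr0// => i /negbTE.
  by rewrite !mxE => ->; rewrite mul0r.
have [r rS hr] : exists2 c, c \in S & forall t, t \in S -> quad A c^T <= quad A t^T.
  apply: EVT_min_rV => //; apply: continuous_subspaceT => r.
  have -> : (fun r : 'rV[R]_n => quad A r^T) = (fun r => dot r^T (A *m r^T)).
    by apply/funext => ?; rewrite quadE.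
  exact: continuous_dot_mulmx.
rewrite inE /S/= -sqr_enorm in rS.
have e1 : enorm r^T = 1.
  by apply/eqP; rewrite -(@eqrXn2 _ 2) ?enorm_ge0// rS expr1n.
have lb : forall u, quad A r^T * enorm u ^+ 2 <= quad A u.
  apply: quad_lb_sphere => u u1; rewrite -(trmxK u); apply: hr.
  by rewrite inE /S/= trmxK -sqr_enorm u1 expr1n.
have Ar := quad_lb_eigen A (quad A r^T) r^T As lb.
rewrite e1 expr1n mulr1 in Ar; have {}Ar := Ar erefl.
exists (quad A r^T); last by have := Ac r^T; rewrite e1 expr1n mulr1.
split.
  (* [eigenvalue] speaks of row eigenvectors; the symmetry of [A] allows the transposition. *)
  apply/eigenvalueP; exists r; last first.
    apply/eqP => r0; move: e1; rewrite r0 trmx0 enorm0 => /eqP.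
    by rewrite eq_sym oner_eq0.
  by apply: trmx_inj; rewrite trmx_mul As Ar linearZ.
move=> a /eigenvalueP[s sA s0].
have sAT : A *m s^T = a *: s^T by rewrite -{1}As -trmx_mul sA linearZ.
have := lb s^T; rewrite (quadE A s^T) sAT.
rewrite dotZr -sqr_enorm ler_pM2r// exprn_gt0// enorm_gt0.
by apply: contra s0 => /eqP e; rewrite -(trmxK s) e trmx0.
Qed.

End Eigenvalues.

(** * Derivatives of [f] and of its gradient along a line *)

Section LineDerivatives.
Context {R : realType}.

Lemma col_sum_delta n (d : 'cV[R]_n) : d = \sum_i d i 0 *: delta_mx i 0.
Proof.
apply/matrixP => i j; rewrite (ord1 j) summxE (bigD1 i)//= !mxE !eqxx mulr1.
rewrite big1 ?addr0// => k /negbTE ki.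
by rewrite !mxE eq_sym ki mulr0.
Qed.

(** Chain rule for [g] composed with the affine map [r |-> x + r *: d]. *)
Lemma is_derive_line n (W : normedModType R) (g : 'cV[R]_n -> W) (x d : 'cV[R]_n)
    (s : R) : differentiable g (x + s *: d) ->
  is_derive s 1 (fun r : R => g (x + r *: d)) ('D_d g (x + s *: d)).
Proof.
move=> dg; pose l := fun r : R => x + r *: d.
have dl : is_diff s l (fun r => r *: d).
  have := is_diffD (is_diff_cst x s) (is_diff_scalel s d).
  by rewrite add0r.
have dgl : is_diff s (g \o l) ('d g (l s) \o (fun r => r *: d)).
  apply: is_diff_comp; exact: differentiableP.
apply: DeriveDef; first by apply: diff_derivable; exact: ex_diff.
by rewrite deriveE// diff_val /= scale1r deriveE.
Qed.

Lemma derive_grad n (f : 'cV[R]_n -> R) (x d : 'cV[R]_n) :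
  differentiable f x -> 'D_d f x = dot (grad f x) d.
Proof.
move=> df; rewrite deriveE// {1}(col_sum_delta n d) linear_sum dotE.
by apply: eq_bigr => i _; rewrite linearZ/= -deriveE// mxE mulrC.
Qed.

Lemma derive_hess n (f : 'cV[R]_n -> R) (x d : 'cV[R]_n) :
  differentiable (grad f) x -> 'D_d (grad f) x = hess f x *m d.
Proof.
move=> df; rewrite deriveE// {1}(col_sum_delta n d) linear_sum.
apply/matrixP => k j; rewrite (ord1 j) summxE mxE.
apply: eq_bigr => i _; rewrite linearZ/= -deriveE// derive_mx.
  by rewrite !mxE mulrC.
exact: diff_derivable.
Qed.

Lemma is_derive_f_line n (f : 'cV[R]_n -> R) (x d : 'cV[R]_n) (s : R) :
  (forall y, differentiable f y) ->
  is_derive s 1 (fun r : R => f (x + r *: d)) (dot (grad f (x + s *: d)) d).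
Proof. by move=> df; rewrite -derive_grad//; exact: is_derive_line. Qed.

Lemma dot_is_linear n (u : 'cV[R]_n) : linear (dot u : 'cV[R]_n -> R^o).
Proof. by move=> a v w; rewrite dotDr dotZr. Qed.

(** Registers linearity so that [linear_differentiable] and [diff_lin] apply to [dot u]. *)
HB.instance Definition _ n (u : 'cV[R]_n) :=
  GRing.isLinear.Build R 'cV[R]_n R^o _ (dot u) (dot_is_linear n u).

Lemma continuous_dot n (u : 'cV[R]_n) : continuous (dot u : 'cV[R]_n -> R^o).
Proof.
have -> : dot u = \sum_i (u i 0 *: (fun w : 'cV[R]_n => w i 0 : R^o)).
  by apply/funext => w; rewrite dotE fct_sumE.
move=> y; apply: differentiable_continuous; apply: differentiable_sum => i.
apply: differentiableZ; exact: differentiable_coord.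
Qed.

Lemma is_derive_grad_line n (f : 'cV[R]_n -> R) (u x d : 'cV[R]_n) (s : R) :
  (forall y, differentiable (grad f) y) ->
  is_derive s 1 (fun r : R => dot u (grad f (x + r *: d)))
    (dot u (hess f (x + s *: d) *m d)).
Proof.
move=> df; set y := x + s *: d.
have cu := @continuous_dot n u.
have du z : differentiable (dot u : 'cV[R]_n -> R^o) z.
  exact: linear_differentiable.
have dg : differentiable ((dot u : 'cV[R]_n -> R^o) \o grad f) y.
  exact: differentiable_comp.
have <- : 'D_d ((dot u : 'cV[R]_n -> R^o) \o grad f) y = dot u (hess f y *m d).
  by rewrite deriveE// diff_comp//= diff_lin// -deriveE// derive_hess.
exact: is_derive_line.
Qed.

End LineDerivatives.

(** * Symmetry of the Hessian *)

Section Schwarz.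
Context {R : realType}.

(* The left-hand side is symmetric in [u] and [v]; Schwarz's theorem follows by
   letting [s] tend to 0. *)
Lemma hess_mixed_difference n (f : 'cV[R]_n -> R) (x u v : 'cV[R]_n) (s : R) :
  (forall y, differentiable f y) -> (forall y, differentiable (grad f) y) ->
  0 < s -> exists r q : R, [/\ 0 <= r <= s, 0 <= q <= s &
    f (x + s *: u + s *: v) - f (x + s *: u) - (f (x + s *: v) - f x) =
    s ^+ 2 * dot v (hess f (x + r *: v + q *: u) *m u)].
Proof.
move=> df dg s0.
(* The mean value theorem is used twice: in the direction [v] for [h], the increment of [f] along
   [s *: u], then in the direction [u] for the slope [k] of [f] along [v]. *)
pose h r := f (x + s *: u + r *: v) - f (x + r *: v).
pose dh r := dot (grad f (x + s *: u + r *: v)) v - dot (grad f (x + r *: v)) v.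
have hd (r : R) : is_derive r 1 h (dh r).
  by apply: is_deriveB; exact: is_derive_f_line.
have [r] : exists2 r, r \in `]0, s[ & h s - h 0 = dh r * (s - 0).
  apply: MVT => //.
  apply: derivable_within_continuous => r _; exact: ex_derive.
rewrite in_itv/= => /andP[r0 rs] hr.
pose k q := dot v (grad f (x + r *: v + q *: u)).
pose dk q := dot v (hess f (x + r *: v + q *: u) *m u).
have kd (q : R) : is_derive q 1 k (dk q) by exact: is_derive_grad_line.
have [q] : exists2 q, q \in `]0, s[ & k s - k 0 = dk q * (s - 0).
  apply: MVT => //.
  apply: derivable_within_continuous => q _; exact: ex_derive.
rewrite in_itv/= => /andP[q0 qs] kq.
exists r, q; split; [by rewrite !ltW|by rewrite !ltW|].
have ks : k s - k 0 = dh r.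
  by rewrite /k /dh scale0r addr0 !(dotC v) (addrAC x (s *: u)).
transitivity (h s - h 0); first by rewrite /h scale0r !addr0; ring.
rewrite hr -ks kq /dk; ring.
Qed.

Lemma symmetric_dotP n (A : 'M[R]_n) :
  (forall u v, dot u (A *m v) = dot v (A *m u)) -> A^T = A.
Proof.
have E i j : A i j = dot (delta_mx i 0) (A *m delta_mx j 0).
  by rewrite /dot trmx_delta mulmxA -rowE -colE !mxE.
by move=> h; apply/matrixP => i j; rewrite mxE !E h.
Qed.

Lemma continuous_dot_hess n (f : 'cV[R]_n -> R) (u v : 'cV[R]_n) :
  continuous (hess f) -> continuous (fun y => dot u (hess f y *m v)).
Proof.
move=> ch.
have cA : continuous (fun A : 'M[R]_n => dot u (A *m v) : R^o).
  have -> : (fun A : 'M[R]_n => dot u (A *m v)) =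
      \sum_i u i 0 *: \sum_j (v j 0 *: (fun A : 'M[R]_n => A i j : R^o)).
    apply/funext => A; rewrite dotE fct_sumE; apply: eq_bigr => i _.
    rewrite mxE /GRing.scale/= fct_sumE; congr (_ * _); apply: eq_bigr => j _.
    exact: mulrC.
  move=> A; apply: differentiable_continuous; apply: differentiable_sum => i.
  apply: differentiableZ; apply: differentiable_sum => j.
  apply: differentiableZ; exact: differentiable_coord.
move=> y; exact: (continuous_comp (ch y) (cA (hess f y))).
Qed.

Lemma dist_le_of_approx (a b c d e : R) : c = d -> `|a - c| < e / 2 ->
  `|b - d| < e / 2 -> `|b - a| <= e.
Proof.
move=> ->; rewrite distrC => ac bd; rewrite (le_trans (ler_distD d _ _))//.
by rewrite (splitr e) lerD ?ltW//.
Qed.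

Lemma hess_sym n (f : 'cV[R]_n -> R) (x : 'cV[R]_n) :
  twice_continuously_differentiable f -> (hess f x)^T = hess f x.
Proof.
move=> [df dg ch]; apply: symmetric_dotP => u v.
apply/eqP; rewrite -subr_eq0 -normr_eq0 eq_le normr_ge0 andbT.
apply/ler_addgt0Pl => e e0; rewrite addr0.
have e20 : 0 < e / 2 by rewrite divr_gt0.
have /cvgrPdist_lt/(_ _ e20) := continuous_dot_hess n f u v ch x.
have /cvgrPdist_lt/(_ _ e20) := continuous_dot_hess n f v u ch x.
move=> /nbhs_ballP[r1 /= r10 h1] /nbhs_ballP[r2 /= r20 h2].
pose c := `|u| + `|v| + 1; have c0 : 0 < c by rewrite ltr_wpDl// addr_ge0.
(* Both intermediate points then lie within [s * (|u| + |v|) < s * c = Num.min r1 r2] of [x], hence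
   in both balls; the [+ 1] in [c] makes the inequality strict and [c] positive. *)
pose s := Num.min r1 r2 / c.
have m0 : 0 < Num.min r1 r2 by rewrite lt_min r10 r20.
have s0 : 0 < s by rewrite divr_gt0.
have near_x (a b : R) w z : `|w| + `|z| + 1 = c -> 0 <= a <= s -> 0 <= b <= s ->
    `|x - (x + a *: w + b *: z)| < Num.min r1 r2.
  move=> wz /andP[a0 al] /andP[b0 bl].
  rewrite -addrA opprD addNKr normrN (le_lt_trans (ler_normD _ _))// !normrZ.
  rewrite !ger0_norm//; have -> : Num.min r1 r2 = s * c by rewrite divfK// gt_eqF.
  rewrite -wz !mulrDr mulr1 ltr_pwDr// lerD// ler_wpM2r//.
have [a1 [b1 [a1s b1s E1]]] := hess_mixed_difference n f x u v s df dg s0.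
have [a2 [b2 [a2s b2s E2]]] := hess_mixed_difference n f x v u s df dg s0.
(* The two mixed differences are the same number, so the factor [s ^+ 2] cancels and the two Hessian
   forms agree at the respective intermediate points. *)
have E : dot v (hess f (x + a1 *: v + b1 *: u) *m u) =
         dot u (hess f (x + a2 *: u + b2 *: v) *m v).
  apply: (@mulfI _ (s ^+ 2)); first by rewrite expf_eq0/= gt_eqF.
  by rewrite -E1 -E2 (addrAC x (s *: u)); ring.
have n1 := near_x a1 b1 v u _ a1s b1s.
have n2 := near_x a2 b2 u v _ a2s b2s.
have {}n1 := n1 (congr1 (+%R^~ 1) (addrC _ _)); have {}n2 := n2 erefl.
have B1 : ball x r1 (x + a1 *: v + b1 *: u).
  by rewrite -ball_normE/= (lt_le_trans n1)// ge_min lexx.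
have B2 : ball x r2 (x + a2 *: u + b2 *: v).
  by rewrite -ball_normE/= (lt_le_trans n2)// ge_min lexx orbT.
have H1 : `|dot v (hess f x *m u) -
  dot v (hess f (x + a1 *: v + b1 *: u) *m u)| < e / 2 := h1 _ B1.
have H2 : `|dot u (hess f x *m v) -
  dot u (hess f (x + a2 *: u + b2 *: v) *m v)| < e / 2 := h2 _ B2.
exact: (dist_le_of_approx _ _ _ _ _ E H1 H2).
Qed.

End Schwarz.

(** * Taylor bounds under a Lipschitz Hessian *)

Section Taylor.
Context {R : realType}.

(** Both Taylor bounds below apply this to a function on the segment minus its polynomial model,
    remainder included. *)
Lemma le_derive_le0 (k dk : R -> R) : (forall s : R, is_derive s 1 k (dk s)) ->
  (forall s, 0 <= s <= 1 -> dk s <= 0) -> k 1 <= k 0.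
Proof.
move=> kd dk0; have [|c + h] := @MVT R k dk 0 1 ltr01 (fun s _ => kd s).
  by apply: derivable_within_continuous => s _; exact: ex_derive.
rewrite in_itv/= => /andP[c0 c1].
by rewrite -subr_le0 h subr0 mulr1 dk0// !ltW.
Qed.

Lemma is_derive_cubic (a b c s : R) : is_derive s 1
  (fun r : R => a * r + b * r ^+ 2 + c * r ^+ 3) (a + b * (2 * s) + c * (3 * s ^+ 2)).
Proof.
have did := is_derive_id s (1 : R).
have := is_deriveD (is_deriveD (is_deriveZ a did)
  (is_deriveZ b (is_deriveX 2 did))) (is_deriveZ c (is_deriveX 3 did)).
set D := (X in is_derive _ _ _ X); suff -> : D = a + b * (2 * s) + c * (3 * s ^+ 2) by exact.
rewrite /D /GRing.scale/=; ring.
Qed.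

Lemma convex_line n (X : set 'cV[R]_n) (x d : 'cV[R]_n) (s : R) : convex_set X ->
  X x -> X (x + d) -> 0 <= s <= 1 -> X (x + s *: d).
Proof.
move=> cX Xx Xd /andP[s0 s1].
have := cX (x + d) x (Itv01 s0 s1); rewrite !inE => /(_ Xd Xx).
have -> // : x + s *: d = s *: (x + d) + (1 - s) *: x.
by rewrite scalerDr scalerBl scale1r [RHS]addrC subrKA.
Qed.

Section LipschitzHessian.
Variables (n : nat) (f : 'cV[R]_n -> R) (M : R) (X : set 'cV[R]_n).
Hypotheses (df : forall y, differentiable f y)
  (dg : forall y, differentiable (grad f) y).
Hypotheses (cX : convex_set X) (LX : hess_lipschitz_on f M X).

Lemma grad_taylor x d : 0 <= M -> X x -> X (x + d) ->
  enorm (grad f (x + d) - (grad f x + hess f x *m d)) <= M / 2 * enorm d ^+ 2.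
Proof.
move=> M0 Xx Xd; apply: enorm_le_dual => [|u].
  by rewrite mulr_ge0 ?divr_ge0 ?sqr_ge0.
pose q := dot u (hess f x *m d); pose c := M / 2 * enorm d ^+ 2 * enorm u.
(* The remainder [c * s ^+ 2] has derivative [M * s * enorm d ^+ 2 * enorm u], exactly what the
   Lipschitz bound between [x + s *: d] and [x] gives. The zero cubic term allows [is_derive_cubic]
   to be reused. *)
pose k (s : R) := dot u (grad f (x + s *: d)) - (q * s + c * s ^+ 2 + 0 * s ^+ 3).
pose dk (s : R) := dot u (hess f (x + s *: d) *m d) - (q + c * (2 * s) + 0 * (3 * s ^+ 2)).
have : k 1 <= k 0.
  apply: (@le_derive_le0 k dk) => s.
    apply: is_deriveB; first exact: is_derive_grad_line.
    exact: is_derive_cubic.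
  move=> s01; have [s0 s1] := andP s01.
  rewrite /dk /c /q; have yx : enorm (x + s *: d - x) = s * enorm d.
    by rewrite addrAC subrr add0r enormZ ger0_norm.
  have := LX _ _ (convex_line _ _ _ _ _ cX Xx Xd s01) Xx; rewrite yx.
  move: (hess f _) (hess f x) => Hy Hx hL.
  have hp : 0 <= enorm u * enorm d by rewrite mulr_ge0 ?enorm_ge0.
  have := normr_dot_mulmx_le (Hy - Hx) u d.
  rewrite mulmxBl dotDr dotNr => hN.
  have := ler_wpM2r hp hL; have := ler_norm (dot u (Hy *m d) - dot u (Hx *m d)).
  by move: hN; nra.
rewrite /k scale0r addr0 scale1r dotDr dotNr dotDr -/q.
rewrite !expr0n !expr1n/= !mulr0 !mulr1 -/c; lra.
Qed.

Lemma taylor_le x d : 0 <= M -> X x -> X (x + d) ->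
  f (x + d) <= f x + dot (grad f x) d + quad (hess f x) d / 2 +
    M / 6 * enorm d ^+ 3.
Proof.
move=> M0 Xx Xd.
pose q := dot (grad f x) d; pose c := quad (hess f x) d / 2.
pose b := M / 6 * enorm d ^+ 3.
(* Here the derivative of the remainder [b * s ^+ 3] matches [grad_taylor] for the step [s *: d],
   paired with [d]. *)
pose k (s : R) := f (x + s *: d) - (q * s + c * s ^+ 2 + b * s ^+ 3).
pose dk (s : R) := dot (grad f (x + s *: d)) d - (q + c * (2 * s) + b * (3 * s ^+ 2)).
have : k 1 <= k 0.
  apply: (@le_derive_le0 k dk) => s.
    apply: is_deriveB; first exact: is_derive_f_line.
    exact: is_derive_cubic.
  move=> s01; have [s0 s1] := andP s01.
  have := grad_taylor x (s *: d) M0 Xx (convex_line _ _ _ _ _ cX Xx Xd s01).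
  rewrite -scalemxAr enormZ ger0_norm// => hg.
  have := dot_le (grad f (x + s *: d) - (grad f x + s *: (hess f x *m d))) d.
  have := ler_wpM2r (enorm_ge0 d) hg.
  rewrite dotDl dotNl dotDl dotZl -/q (dotC (hess f x *m d)) -quadE /dk /c /b.
  lra.
rewrite /k scale0r addr0 scale1r.
rewrite !expr0n !expr1n/= !mulr0 !mulr1 -/q -/c -/b; lra.
Qed.

End LipschitzHessian.
End Taylor.

(** * The homogenized eigenproblem and the directions it yields *)

Section HSODM.
Context {R : realType}.

Section Homogenized.
Variables (n : nat).
Implicit Types (u v g : 'cV[R]_n) (H : 'M[R]_n) (a t delta : R).

Lemma dot_col_mx u v a t :
  dot (col_mx u a%:M) (col_mx v t%:M : 'cV_(n + 1)) = dot u v + a * t.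
Proof.
rewrite /dot tr_col_mx mul_row_col tr_scalar_mx -scalar_mxM mxE.
by congr (_ + _); rewrite mxE eqxx mulr1n.
Qed.

Lemma block_mul_col_mx H g v delta t :
  block_mx H g g^T (- delta)%:M *m col_mx v t%:M =
  col_mx (H *m v + t *: g) (dot g v - delta * t)%:M.
Proof.
rewrite mul_block_col mul_mx_scalar -scalar_mxM; congr col_mx.
by rewrite [g^T *m v]mx11_scalar -raddfD/= mulNr.
Qed.

Lemma homogenized_minimizer H g v delta t : H^T = H -> 0 < delta ->
  ball_minimizer (block_mx H g g^T (- delta)%:M) (col_mx v t%:M) ->
  exists theta : R, [/\ delta <= theta, dot v v + t ^+ 2 = 1,
    H *m v = - (theta *: v + t *: g), dot g v = t * (delta - theta) &
    forall u, - theta * enorm u ^+ 2 <= quad H u].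
Proof.
move=> Hs d0 wmin; set F := block_mx _ _ _ _ in wmin.
set w : 'cV_(n + 1) := col_mx v _ in wmin.
have Fs : F^T = F by rewrite /F tr_block_mx Hs trmxK tr_scalar_mx.
(* The last basis vector has value [- delta], so the minimum is at most [- delta < 0]; this gives
   both [delta <= theta] and the sign needed by [ball_minimizer_eigen]. *)
have Fe : quad F (col_mx 0 1%:M) = - delta.
  by rewrite quadE block_mul_col_mx dot_col_mx dotC dot0r dot0r; ring.
have Fw : quad F w <= - delta.
  rewrite -Fe; apply: wmin.2.
  by rewrite enormE dot_col_mx dot0r add0r mulr1 sqrtr1.
have Fw0 : quad F w < 0 by rewrite (le_lt_trans Fw)// oppr_lt0.
have [w1 Fwe lb] := ball_minimizer_eigen F w Fs wmin Fw0.
exists (- quad F w); split.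
- by rewrite lerNr.
- by rewrite expr2 -dot_col_mx -sqr_enorm w1 expr1n.
- move: Fwe; rewrite {1}/w block_mul_col_mx {2}/w scale_col_mx.
  by move=> /eq_col_mx[e _]; rewrite scaleNr opprD opprK -e addrK.
- move: Fwe; rewrite {1}/w block_mul_col_mx {2}/w scale_col_mx.
  move=> /eq_col_mx[_ /matrixP/(_ 0 0)]; rewrite !mxE eqxx !mulr1n.
  by move=> /eqP; rewrite subr_eq => /eqP ->; ring.
(* On vectors with last entry 0 the form of [F] is that of [H]. *)
- move=> u; have := lb (col_mx u 0%:M).
  rewrite sqr_enorm dot_col_mx mulr0 addr0 -sqr_enorm (quadE F (col_mx u _)).
  by rewrite block_mul_col_mx dot_col_mx mul0r addr0 scale0r addr0 -quadE opprK.
Qed.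

(* Writing the step as [c *: v], the quadratic model changes by
   [(theta - delta) * ((c t) ^ 2 / 2 - c t) - theta Delta ^ 2 / 2]; both large value
   cases satisfy [`|c t| <= 1] and [0 <= (theta - delta) (c t)]. *)
Lemma model_decrease H g v a t delta theta Delta : 0 <= Delta -> delta <= theta ->
  H *m v = - (theta *: v + t *: g) -> dot g v = t * (delta - theta) ->
  v != 0 -> a != 0 -> 0 <= (theta - delta) * (a * t) ->
  Delta ^+ 2 * t ^+ 2 <= dot v v ->
  let d := (Delta / enorm (a *: v)) *: (a *: v) in
  enorm d = Delta /\ dot g d + quad H d / 2 <= - (theta * Delta ^+ 2 / 2).
Proof.
move=> D0 dt Hv gv v0 a0 sg tD d.
have vp : 0 < enorm v by rewrite enorm_gt0.
have ep : 0 < enorm (a *: v) by rewrite enorm_gt0 scaler_eq0 negb_or a0.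
have e1 : enorm d = Delta.
  by rewrite enormZ ger0_norm ?divr_ge0// ?divfK ?gt_eqF// ltW.
split=> //; pose c := Delta / enorm (a *: v) * a.
have dE : d = c *: v by rewrite /d scalerA.
have cv : c ^+ 2 * dot v v = Delta ^+ 2.
  have := congr1 (fun r => r ^+ 2) e1.
  by rewrite dE enormZ exprMn sqr_enorm real_normK ?num_real.
have ct1 : `|c * t| <= 1.
  rewrite -(@expr_le1 _ 2)// real_normK ?num_real//.
  have vvp : 0 < dot v v by rewrite -sqr_enorm exprn_gt0.
  by rewrite -(ler_pM2r vvp) mul1r exprMn mulrAC cv.
have sc : 0 <= (theta - delta) * (c * t).
  have -> : (theta - delta) * (c * t) =
    Delta / enorm (a *: v) * ((theta - delta) * (a * t)) by rewrite /c; ring.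
  by rewrite mulr_ge0// divr_ge0// ltW.
have key : (theta - delta) * (c * t) ^+ 2 <= (theta - delta) * (c * t).
  rewrite -(ger0_norm sc) normrM (ger0_norm (_ : 0 <= theta - delta)) ?subr_ge0//.
  rewrite ler_wpM2l ?subr_ge0// -real_normK ?num_real// expr2.
  by rewrite ler_piMr.
rewrite dE quadZ quadE Hv dotZr gv dotNr dotDr !dotZr (dotC v g) gv.
rewrite -cv; move: key sc; lra.
Qed.

End Homogenized.


(** For a unit vector [[v; t]] the right-hand side is [dot v v], so a large value means
    [Delta * |t| <= enorm v]. The next lemma likewise gives [enorm (t^-1 *: v) < Delta]. *)
Lemma small_valueN_sqr (Delta t : R) :
  ~~ small_value Delta t -> Delta ^+ 2 * t ^+ 2 <= 1 - t ^+ 2.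
Proof.
have D1 : 0 < 1 + Delta ^+ 2 by rewrite ltr_pwDl// sqr_ge0.
have D2 : 0 <= 1 / (1 + Delta ^+ 2) by rewrite divr_ge0// ltW.
rewrite /small_value -leNgt => h.
have : t ^+ 2 <= 1 / (1 + Delta ^+ 2).
  rewrite -[t ^+ 2]real_normK ?num_real// -[leRHS]sqr_sqrtr//.
  by rewrite ler_sqr ?nnegrE ?sqrtr_ge0.
rewrite ler_pdivlMr//; lra.
Qed.

Lemma small_value_sqr (Delta t : R) :
  small_value Delta t -> 1 - t ^+ 2 < Delta ^+ 2 * t ^+ 2.
Proof.
have D1 : 0 < 1 + Delta ^+ 2 by rewrite ltr_pwDl// sqr_ge0.
have D2 : 0 <= 1 / (1 + Delta ^+ 2) by rewrite divr_ge0// ltW.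
rewrite /small_value => h.
have : 1 / (1 + Delta ^+ 2) < t ^+ 2.
  rewrite -[t ^+ 2]real_normK ?num_real// -[ltLHS]sqr_sqrtr//.
  by rewrite ltr_sqr ?nnegrE ?sqrtr_ge0.
rewrite ltr_pdivrMr//; lra.
Qed.

(** Merges the two large value cases: the factor is [t^-1], with [t != 0] by [nu <= |t|], or a sign.
    Since [- g.v = (theta - delta) * t], that sign makes [(theta - delta) * (a * t)] nonnegative. *)
Lemma hsodm_directionP n (Delta nu t delta theta : R) (g v : 'cV[R]_n) :
  0 < nu -> delta <= theta -> dot g v = t * (delta - theta) ->
  ~~ small_value Delta t -> exists a, [/\ a != 0,
    0 <= (theta - delta) * (a * t) & hsodm_direction Delta nu g v t = a *: v].
Proof.
move=> nu0 dt gv st; rewrite /hsodm_direction (negbTE st).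
case: ifPn => [nut|_].
  have t0 : t != 0 by rewrite -normr_gt0 (lt_le_trans nu0).
  by exists t^-1; rewrite invr_eq0 t0 mulVf// mulr1 subr_ge0.
have -> : (- g^T *m v) 0 0 = (theta - delta) * t.
  by rewrite mulNmx mxE -/(dot g v) gv; ring.
rewrite /sign1; case: ifPn => h; [exists 1|exists (-1)].
  by rewrite oner_eq0 mul1r.
rewrite oppr_eq0 oner_eq0 mulN1r mulrN oppr_ge0; split=> //.
by rewrite ltW// ltNge.
Qed.

(** * Effect of one iteration: decrease of [f], or approximate stationarity *)

Section Steps.
Variables (n : nat) (f : 'cV[R]_n -> R) (M : R) (X : set 'cV[R]_n).
Hypotheses (C2f : twice_continuously_differentiable f) (M0 : 0 < M).
Hypotheses (cX : convex_set X) (LX : hess_lipschitz_on f M X).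
Variables (x v : 'cV[R]_n) (t Delta nu delta : R).
Hypotheses (delta0 : 0 < delta) (DeltaE : delta = M * Delta / 2).
Hypothesis wmin : ball_minimizer (homogenized f delta x) (col_mx v t%:M).
Let xnext := hsodm_next Delta nu (grad f x) v t x.
Hypotheses (Xx : X x) (Xn : X xnext).

Let df y : differentiable f y. Proof. by case: C2f. Qed.
Let dg y : differentiable (grad f) y. Proof. by case: C2f. Qed.

Let Delta0 : 0 < Delta.
Proof. by move: delta0; rewrite DeltaE pmulr_lgt0// pmulr_rgt0. Qed.

Lemma large_value_decrease : 0 < nu -> ~~ small_value Delta t ->
  f xnext <= f x - M * Delta ^+ 3 / 12.
Proof.
move=> nu0 st.
have [theta [dt vt Hv gv lb]] := homogenized_minimizer _ _ _ _ _ _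
  (hess_sym _ _ x C2f) delta0 wmin.
have [a [a0 sg dE]] := hsodm_directionP _ _ _ _ _ _ _ _ nu0 dt gv st.
have Dt := small_valueN_sqr _ _ st.
(* If [v = 0] then [t ^+ 2 = 1], and [Dt] would give [Delta ^+ 2 <= 0]. *)
have v0 : v != 0.
  apply/eqP => v0; move: vt Dt; rewrite v0 dot0r add0r => ->.
  by rewrite mulr1 subrr leNgt exprn_gt0.
have Dv : Delta ^+ 2 * t ^+ 2 <= dot v v by rewrite (le_trans Dt)// -vt addrK.
have [de dec] := model_decrease _ _ _ _ _ _ _ _ _ (ltW Delta0) dt Hv gv v0 a0 sg Dv.
move: Xn; rewrite /xnext /hsodm_next (negbTE st) dE => Xn'.
have := taylor_le _ _ _ _ df dg cX LX _ _ (ltW M0) Xx Xn'.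
rewrite de; move: dec; set m := dot _ _; set q := quad _ _ => dec.
(* As [theta >= delta = M * Delta / 2], the decrease is at least [M * Delta ^+ 3 * (1/4 - 1/6)]. *)
have : delta * Delta ^+ 2 <= theta * Delta ^+ 2 by rewrite ler_wpM2r ?sqr_ge0.
move: dec; rewrite DeltaE; lra.
Qed.

Lemma small_value_next (U : R) : Delta ^+ 2 <= 1 / 2 -> small_value Delta t ->
  opnorm (hess f x) <= U ->
  exists theta, [/\ theta <= 2 * delta + 2 * U * Delta ^+ 2,
    enorm (grad f xnext) <= M / 2 * Delta ^+ 2 + theta * Delta &
    forall u, - (theta + M * Delta) * enorm u ^+ 2 <= quad (hess f xnext) u].
Proof.
move=> D2 st hU.
have [theta [dt vt Hv gv lb]] := homogenized_minimizer _ _ _ _ _ _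
  (hess_sym _ _ x C2f) delta0 wmin.
have Dt := small_value_sqr _ _ st; exists theta.
have t0 : t != 0.
  by apply: contraTneq st => ->; rewrite /small_value normr0 -leNgt sqrtr_ge0.
move: Xn; rewrite /xnext /hsodm_next /hsodm_direction st.
set d := t^-1 *: v; set y := x + d => Xy; set H := hess f x in Hv lb hU *.
set g := grad f x in Hv gv *.
have dD : enorm d <= Delta.
  rewrite -ler_sqr ?nnegrE ?enorm_ge0 ?(ltW Delta0)// sqr_enorm dotZl dotZr.
  have t20 : 0 < t ^+ 2 by rewrite exprn_even_gt0.
  rewrite -(ler_pM2r t20) (_ : _ * _ * _ = dot v v); last by field.
  by rewrite -(addrK (t ^+ 2) (dot v v)) vt ltW.
have Hd : H *m d = - (theta *: d + g).
  rewrite -scalemxAr Hv scalerN scalerDr !scalerA mulVf// scale1r.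
  by rewrite mulrC -scalerA.
have gd : dot g d = delta - theta by rewrite dotZr gv mulKf.
have th0 : 0 < theta := lt_le_trans delta0 dt.
have d0 := enorm_ge0 d.
have gU : enorm g <= (U + theta) * Delta.
  have -> : g = - (theta *: d + H *m d) by rewrite Hd opprD opprK addKr.
  rewrite enormN (le_trans (enormD _ _))//.
  rewrite enormZ (ger0_norm (ltW th0)); have := enorm_mulmx_le H d.
  have := ler_wpM2r d0 hU.
  have := ler_wpM2l (le_trans (opnorm_ge0 H) hU) dD.
  have := ler_wpM2l (ltW th0) dD; lra.
split.
(* [theta = delta - g.d <= delta + (U + theta) * Delta ^+ 2], and [Delta ^+ 2 <= 1 / 2] lets half of
   [theta] be absorbed on the left. *)
- have := dot_le g (- d); rewrite dotNr gd enormN.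
  have := ler_pM (enorm_ge0 g) d0 gU dD.
  have := ler_wpM2l (ltW th0) D2; lra.
(* The linear model [g + H *m d] of the new gradient equals [- theta *: d]; the Taylor remainder
   adds [M / 2 * Delta ^+ 2]. *)
- have := grad_taylor _ _ _ _ dg cX LX x d (ltW M0) Xx Xy.
  rewrite -/H -/g Hd -/y opprD opprK (addrC (- g)) addrK => hT.
  have -> : grad f y = (grad f y + theta *: d) + (- theta) *: d.
    by rewrite scaleNr addrK.
  rewrite (le_trans (enormD _ _))// enormZ normrN ger0_norm ?(ltW th0)//.
  rewrite lerD// ?ler_wpM2l ?(ltW th0)// (le_trans hT)// ler_wpM2l ?divr_ge0 ?(ltW M0)//.
  by rewrite ler_sqr ?nnegrE// ltW.
- move=> u; apply: le_trans (quad_perturb_le H (hess f y) u).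
  rewrite opprD mulrDl; apply: lerD; first exact: lb.
  rewrite mulNr lerN2; apply: ler_wpM2r; first exact: sqr_ge0.
  apply: le_trans (LX _ _ Xy Xx) _; apply: ler_wpM2l; first exact: ltW.
  by rewrite /y addrAC subrr add0r.
Qed.

End Steps.

End HSODM.

(** * Counting iterations *)

Section Complexity.
Context {R : realType}.

Lemma executed_leq (Delta : R) (t : nat -> R) (j k : nat) :
  (j <= k)%N -> executed Delta t k -> executed Delta t j.
Proof. by move=> jk ek i ij; apply: ek; exact: leq_trans ij jk. Qed.

Lemma first_termination (Delta : R) (t : nat -> R) (K : nat) :
  ~ executed Delta t K -> exists2 k, terminates_at Delta t k & (k < K)%N.
Proof.
move=> eK; have ex : exists j, (j < K)%N && small_value Delta (t j).
  apply: contrapT => nex; apply: eK => j jK; apply/negP => sj.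
  by apply: nex; exists j; rewrite jK.
case: (ex_minnP ex) => k /andP[kK sk] kmin; exists k => //; split=> // j jk.
apply/negP => sj; have := kmin j; rewrite sj (ltn_trans jk kK) => /(_ isT).
by rewrite leqNgt jk.
Qed.

(** If iteration [k] is executed, the [k] earlier ones each lowered [F] by at least [c], so
    [k * c <= gap]. This fails at an index [K > gap / c], hence termination occurs before [K]. *)
Lemma terminates_of_decrease (Delta c gap : R) (t F : nat -> R) : 0 < c ->
  (forall k, F 0%N - F k <= gap) ->
  (forall k, executed Delta t k.+1 -> F k.+1 <= F k - c) ->
  exists2 k, terminates_at Delta t k & k%:R * c <= gap.
Proof.
move=> c0 Fgap Fdec.
have Fk k : executed Delta t k -> k%:R * c <= gap.
  move=> ek; apply: le_trans (Fgap k).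
  elim: k ek => [|k IH] ek; first by rewrite mul0r subrr.
  have := Fdec k ek; have := IH (executed_leq _ _ _ _ (leqnSn k) ek).
  by rewrite -natr1 mulrDl mul1r; lra.
pose K := (Num.truncn (gap / c)).+1.
have [|k tk _] := first_termination Delta t K; last first.
  by exists k => //; apply: Fk; case: tk.
move=> /Fk; rewrite -ler_pdivlMr// leNgt => /negP; apply.
exact: truncnS_gt.
Qed.

Lemma powR_N32 (a : R) : 0 < a -> a `^ (- (3 / 2)) = (Num.sqrt a ^+ 3)^-1.
Proof.
move=> a0; rewrite powRN; congr (_^-1).
by rewrite mulrC powRrM powR12_sqrt ?ltW// -powR_mulrn ?sqrtr_ge0.
Qed.

End Complexity.

(** * Choice of the constants, and the bounds in terms of the tolerance *)

Theorem theorem3p1 (R : realType) (M UH gap : R) (hM : 0 < M) (hUH : 0 < UH) :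
  exists C1 C2 C3 : R, [/\ 0 < C1, 0 < C2, 0 < C3 &
    forall (n : nat) (f : 'cV[R]_n -> R) (X : set 'cV[R]_n) (eps nu : R)
      (x v : nat -> 'cV[R]_n) (t : nat -> R),
    let delta := Num.sqrt eps in
    let Delta := 2 * Num.sqrt eps / M in
    (0 < n)%N ->
    twice_continuously_differentiable f ->
    has_lbound (range f) ->
    f (x 0%N) - inf (range f) = gap ->
    0 < eps -> Delta <= Num.sqrt 2 / 2 ->
    0 < nu -> nu < 1 / 2 ->
    hsodm_run f delta Delta nu x v t ->
    open X -> convex_set X ->
    (forall k : nat, is_iterate Delta t k -> X (x k)) ->
    hess_lipschitz_on f M X ->
    (forall k : nat, is_iterate Delta t k -> opnorm (hess f (x k)) <= UH) ->
    (exists2 k : nat, terminates_at Delta t k &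
      k.+1%:R <= C1 * eps `^ (- (3 / 2))) /\
    (forall k : nat, terminates_at Delta t k ->
      enorm (grad f (x k.+1)) <= C2 * eps /\
      exists2 l : R, smallest_eigenvalue (hess f (x k.+1)) l &
        - C3 * Num.sqrt eps <= l)].
Proof.
(* [T] is chosen so that [theta <= T * Num.sqrt eps]: as [Delta <= 1], [2 * delta + 2 * UH * Delta
   ^+ 2 <= 2 * delta + 2 * UH * Delta = T * delta]. *)
pose T := 2 + 4 * UH / M.
have T0 : 0 < T by rewrite ltr_pwDl// divr_ge0// ?(ltW hM)// mulr_ge0// ltW.
(* The first constant comes from [12 * gap / (M * Delta ^+ 3) = 3 / 2 * M ^+ 2 * gap / delta ^+ 3],
   with [M ^+ 3] added for the terminating iteration and [|gap|] for positivity. The second collects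
   [M / 2 * Delta ^+ 2 + T * delta * Delta], the third [T * delta + M * Delta]. *)
exists (3 / 2 * M ^+ 2 * `|gap| + M ^+ 3), ((2 + 2 * T) / M), (T + 2).
split.
- by rewrite ltr_wpDl ?exprn_gt0// mulr_ge0// mulr_ge0 ?sqr_ge0.
- by rewrite divr_gt0// ltr_pwDl// mulr_ge0// ltW.
- by rewrite addr_gt0.
move=> n f X eps nu x v t delta Delta n0 C2f lbf fgap eps0 hD nu0 nu1 run oX cX itX
  LX hU.
have d0 : 0 < delta by rewrite sqrtr_gt0.
have D0 : 0 < Delta by rewrite divr_gt0// mulr_gt0.
have dE : delta = M * Delta / 2 by rewrite /Delta -/delta; field; rewrite gt_eqF.
have D2 : Delta ^+ 2 <= 1 / 2.
  have -> : 1 / 2 = (Num.sqrt 2 / 2) ^+ 2 :> R by rewrite expr_div_n sqr_sqrtr//; field.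
  by rewrite ler_sqr// nnegrE ?(ltW D0)// divr_ge0.
have D1 : Delta <= 1.
  by rewrite -(@expr_le1 _ 2) ?(ltW D0)//; apply: (le_trans D2); lra.
(* [is_iterate] at [k.+1] is [executed] at [k], so the point returned on termination is covered as
   well. *)
have Xk k : executed Delta t k -> X (x k) /\ X (x k.+1).
  move=> ek; split; apply: itX => //.
  by apply: executed_leq ek; exact: leq_pred.
have hUk k : executed Delta t k -> opnorm (hess f (x k)) <= UH.
  by move=> ek; apply: hU; apply: executed_leq ek; exact: leq_pred.
split.
  have c0 : 0 < M * Delta ^+ 3 / 12 by rewrite divr_gt0// mulr_gt0// exprn_gt0.
  have [||k tk kle] :=
    @terminates_of_decrease _ Delta _ gap t (fun k => f (x k)) c0.
  - move=> k; rewrite -fgap lerD2l lerN2; exact: ge_inf.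
  - move=> k ek; have ek' := executed_leq _ _ _ _ (leqnSn k) ek.
    have [wm ->] := run k ek'; have [Xx Xn] := Xk k ek'.
    apply: (large_value_decrease _ _ _ _ C2f hM cX LX _ _ _ _ _ _ d0 dE wm Xx) => //.
      by case: (run k ek') => _ <-.
    exact: ek.
  exists k => //; rewrite powR_N32// ler_pdivlMr ?exprn_gt0// -/delta.
  have kc : k%:R * delta ^+ 3 <= 3 / 2 * M ^+ 2 * gap.
    have m0 : 0 <= 3 / 2 * M ^+ 2 by rewrite mulr_ge0 ?sqr_ge0.
    apply: le_trans (ler_wpM2l m0 kle).
    by rewrite dE le_eqVlt; apply/orP; left; apply/eqP; field.
  (* Iterations are numbered from 0, so the count is [k.+1]; the extra 1 is paid for by
     [1 <= M ^+ 3 / delta ^+ 3], which holds since [delta = M * Delta / 2 <= M]. *)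
  have dM : delta ^+ 3 <= M ^+ 3.
    rewrite lerXn2r ?nnegrE ?(ltW d0) ?(ltW hM)// dE.
    by have := ler_wpM2l (ltW hM) D1; lra.
  rewrite -natr1 mulrDl mul1r lerD// (le_trans kc)// ler_wpM2l ?ler_norm//.
  by rewrite mulr_ge0 ?sqr_ge0.
move=> k [ek sk]; have [wm xn] := run k ek; have [Xx Xn] := Xk k ek.
rewrite xn in Xn *.
have [theta [th gn Hn]] := small_value_next _ _ _ _ C2f hM cX LX _ _ _ _ _ _
  d0 dE wm Xx Xn _ D2 sk (hUk k ek).
have MD : M * Delta = 2 * delta by rewrite dE; field.
have thT : theta <= T * delta.
  apply: (le_trans th); have -> : T * delta = 2 * delta + 2 * UH * Delta.
    by rewrite /T dE; field; rewrite gt_eqF.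
  rewrite lerD2l ler_wpM2l ?mulr_ge0 ?(ltW hUH)// expr2.
  by rewrite ler_piMr ?(ltW D0).
split.
  apply: (le_trans gn).
  have -> : eps = delta ^+ 2 by rewrite sqr_sqrtr ?ltW.
  have -> : (2 + 2 * T) / M * delta ^+ 2 = M / 2 * Delta ^+ 2 + T * delta * Delta.
    by rewrite dE; field; rewrite gt_eqF.
  by rewrite lerD2l ler_wpM2r// ltW.
have [l lmin ll] := smallest_eigenvalue_exists _ _ _ n0 (hess_sym _ _ _ C2f) Hn.
exists l => //; apply: le_trans ll.
by rewrite MD; move: thT; rewrite -/delta; lra.
Qed.
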